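(* Let $n>d>2$ be integers and let $\mathcal{T}=(T_i)_{i=d}^{n-1}$ be a BBC sequence of simplicial $(d-1)$-balls. Then the facets (maximal faces) of the cubical complex $\mathrm{BBC}(\mathcal{T})$ are exactly the sign vectors $\alpha\in\{0,\pm1\}^n$ with exactly $d$ zero entries that are of one of the following types, where the type $t$ is the number of trailing non-zero entries of $\alpha$: \begin{itemize} \item type $t=0$: $\alpha_n=0$ and $|(\alpha_1,\ldots,\alpha_{n-1})|\in\partial T_{n-1}$; \item type $0<t<n-d$: $\alpha=(\beta,0,\sigma,-1,\ldots,-1)$ (with $t-1$ trailing entries $-1$), where $\sigma\in\{\pm1\}$, $\beta\in\{0,\pm1\}^{n-t-1}$, such that (1) $|\beta|\in\partial T_{n-t-1}$, and (2) if $\sigma=+1$ then $|(\beta,0)|\in T_{n-t}$, and if $\sigma=-1$ then $|(\beta,0)|\notin T_{n-t}$; \item type $t=n-d$: $\alpha=(0,\ldots,0,\sigma,-1,\ldots,-1)$ with $d$ leading zeros, $\sigma\in\{-1,+1\}$, followed by $n-d-1$ entries $-1$. \end{itemize}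
   Context: Faces of the $m$-cube $C_m=[-1,1]^m$: nonempty faces correspond bijectively to sign vectors $\sigma\in\{0,+1,-1\}^m$, where $\sigma$ corresponds to $\{x\in C_m: x_j=\sigma_j \text{ whenever } \sigma_j\neq 0\}$; the dimension of this face is the number of zeros of $\sigma$. A cubical subcomplex of $C_m$ is a set of such sign vectors closed under taking faces. For $\sigma\in\{0,\pm1\}^m$ write $|\sigma|=(|\sigma_1|,\ldots,|\sigma_m|)$. Encoding of simplicial complexes: a simplicial complex $\Delta$ on ground set $[m]=\{1,\ldots,m\}$ is encoded by identifying each face $\phi\subseteq[m]$ with the characteristic vector in $\{0,1\}^m$ of its complement $[m]\setminus\phi$. Thus for $\sigma\in\{0,\pm1\}^m$, ''$|\sigma|\in\Delta$'' means that the zero set $\{j:\sigma_j=0\}$ is a face of $\Delta$. The mirror complex of $\Delta$ is $M(\Delta)=\{\sigma\in\{0,\pm1\}^m: |\sigma|\in\Delta\}$, a subcomplex of $C_m$. BBC sequence: for integers $n>d\ge 3$, a sequence $\mathcal{T}=(T_i)_{i=d}^{n-1}$ of simplicial $(d-1)$-balls, $T_i$ having vertex set $[i]$, such that $T_d$ is the $(d-1)$-simplex on $[d]$ and, for $i=d+1,\ldots,n-1$, $T_i=B_{i-1}*\{i\}$ (the cone with apex $i$) where $B_{i-1}$ is a simplicial $(d-2)$-ball with vertex set $[i-1]$ which is a subcomplex of the boundary sphere $\partial T_{i-1}$. The complex $\mathrm{BBC}(\mathcal{T})$: let $S_{d+1}$ be the boundary complex of $C_{d+1}$ (all nonzero sign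 vectors in $\{0,\pm1\}^{d+1}$). For $k=d+2,\ldots,n$, the complex $M(T_{k-1})$ is a subcomplex of $S_{k-1}$; let $R_{k-1}$ be the subcomplex of $S_{k-1}$ consisting of all faces of those facets of $S_{k-1}$ which do not belong to $M(T_{k-1})$, and set $S_k=\{(\sigma,+1):\sigma\in M(T_{k-1})\}\cup\{(\sigma,0):\sigma\in M(\partial T_{k-1})\}\cup\{(\sigma,-1):\sigma\in R_{k-1}\}\subseteq\{0,\pm1\}^k$. Then $\mathrm{BBC}(\mathcal{T}):=S_n$; it is a cubical $d$-sphere contained in the boundary of $C_n$. *)

(* Defs.v *)
From HB Require Import structures.
From mathcomp Require Import all_boot.

Set Implicit Arguments.
Unset Strict Implicit.
Unset Printing Implicit Defensive.

Inductive sign := Zero | Plus | Minus.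

Definition option_of_sign (s : sign) : option bool :=
  match s with Zero => None | Plus => Some true | Minus => Some false end.
Definition sign_of_option (o : option bool) : sign :=
  match o with None => Zero | Some true => Plus | Some false => Minus end.
Lemma option_of_signK : cancel option_of_sign sign_of_option.
Proof. by case. Qed.

HB.instance Definition _ := Finite.copy sign (can_type option_of_signK).

(** The ground set [[m] = {1, ..., m}] is ['I_m], the vertex [i] being the
    ordinal [i - 1]; in particular the vertex [m.+1] of [[m.+1]] is
    [ord_max : 'I_m.+1]. A family of faces is given by the faces themselves,
    the empty face included. *)
Section SimplicialComplexes.
Local Open Scope set_scope.

Definition simplicial_complex m (D : {set {set 'I_m}}) : Prop :=
  set0 \in D /\ forall F G : {set 'I_m}, F \subset G -> G \in D -> F \in D.

Definition has_full_vertex_set m (D : {set {set 'I_m}}) : Prop :=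
  forall i : 'I_m, [set i] \in D.

(** Boundary complex of a simplicial [k]-ball: all faces of the
    [(k-1)]-dimensional faces that lie in exactly one [k]-dimensional face
    (a face of dimension [k] has [k.+1] vertices). *)
Definition boundary (k : nat) m (D : {set {set 'I_m}}) : {set {set 'I_m}} :=
  [set F : {set 'I_m} | [exists G : {set 'I_m}, [&& G \in D, #|G| == k,
     #|[set H in D | (G \subset H) && (#|H| == k.+1)]| == 1 &
     F \subset G]]].

Definition old_vertices m (F : {set 'I_m}) : {set 'I_m.+1} :=
  [set lift ord_max j | j in F].

Definition cone m (B : {set {set 'I_m}}) : {set {set 'I_m.+1}} :=
  [set old_vertices F | F in B]
    :|: [set (ord_max |: old_vertices F) | F in B].

End SimplicialComplexes.

Section CubicalComplexes.
Local Open Scope set_scope.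

(** As simplicial complexes are given by their faces, [|s| \in D] reads
    [zeros s \in D]. *)
Definition zeros k (s : k.-tuple sign) : {set 'I_k} :=
  [set j | tnth s j == Zero].

Definition face_of k (s t : k.-tuple sign) : bool :=
  [forall j, (tnth t j != Zero) ==> (tnth s j == tnth t j)].

Definition facet k (X : {set k.-tuple sign}) (s : k.-tuple sign) : bool :=
  (s \in X) && [forall t in X, face_of s t ==> (t == s)].

Definition mirror k (D : {set {set 'I_k}}) : {set k.-tuple sign} :=
  [set s | zeros s \in D].

Definition cube_boundary k : {set k.-tuple sign} :=
  [set s | [exists j, tnth s j != Zero]].

Definition remainder k (S : {set k.-tuple sign}) (D : {set {set 'I_k}}) :
    {set k.-tuple sign} :=
  [set s | [exists t, [&& facet S t, t \notin mirror D & face_of s t]]].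

Definition append k (s : k.-tuple sign) (e : sign) : k.+1.-tuple sign :=
  [tuple of rcons s e].

Definition BBC_step (d k : nat) (S : {set k.-tuple sign})
    (D : {set {set 'I_k}}) : {set k.+1.-tuple sign} :=
  [set append s Plus | s in mirror D]
  :|: [set append s Zero | s in mirror (boundary d.-1 D)]
  :|: [set append s Minus | s in remainder S D].

(** [BBC d T k] is the complex [S_k] of the construction; for [k <= d], where
    [S_k] is not defined, it is empty. *)
Fixpoint BBC (d : nat) (T : forall i : nat, {set {set 'I_i}}) (k : nat) :
    {set k.-tuple sign} :=
  match k with
  | 0 => set0
  | j.+1 => if j < d then set0
            else if j == d then cube_boundary j.+1
            else BBC_step d (BBC d T j) (T j)
  end.

Definition trailing_nonzeros k (s : k.-tuple sign) : nat :=
  find (pred1 Zero) (rev s).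

End CubicalComplexes.

From mathcomp Require Import all_order all_algebra.
From mathcomp Require Import boolp classical_sets reals topology normedtype.

Section Balls.
Import GRing.Theory Num.Theory numFieldNormedType.Exports.
Local Open Scope ring_scope.
Local Open Scope classical_set_scope.

Definition homeomorphic (X Y : topologicalType) (A : set X) (B : set Y) : Prop :=
  exists (f : X -> Y) (g : Y -> X),
    [/\ {within A, continuous f} /\ {within B, continuous g},
        forall x, A x -> B (f x),
        forall y, B y -> A (g y),
        forall x, A x -> g (f x) = x &
        forall y, B y -> f (g y) = y].

Definition geometric_realization (R : realType) m (D : {set {set 'I_m}}) :
    set 'rV[R]_m :=
  [set x | [/\ forall i, 0 <= x ord0 i, \sum_i x ord0 i = 1 &
               [set i | x ord0 i != 0]%SET \in D]].

Definition closed_unit_ball (R : realType) (k : nat) : set 'rV[R]_k :=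
  [set x | \sum_i x ord0 i ^+ 2 <= 1].

Definition simplicial_ball (R : realType) (k : nat) m (D : {set {set 'I_m}}) :
    Prop :=
  simplicial_complex D /\
  homeomorphic (@geometric_realization R m D) (@closed_unit_ball R k).

End Balls.

(** [T i] is only meaningful for [d <= i < n]; other values are ignored. *)
Definition BBC_sequence (R : realType) (d n : nat)
    (T : forall i : nat, {set {set 'I_i}}) : Prop :=
  [/\ forall i, d <= i < n ->
        simplicial_ball R d.-1 (T i) /\ has_full_vertex_set (T i),
      T d = [set: {set 'I_d}]%SET &
      forall i, d <= i -> i.+1 < n -> exists B : {set {set 'I_i}},
        [/\ simplicial_ball R d.-2 B, has_full_vertex_set B,
            B \subset boundary d.-1 (T i) & T i.+1 = cone B]].

(* Main.v *)
Require Import Defs.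
From mathcomp Require Import all_boot all_order all_algebra.
From mathcomp Require Import ring lra zify.

Set Implicit Arguments.
Unset Strict Implicit.
Unset Printing Implicit Defensive.
Import Order.TTheory GRing.Theory Num.Theory.

(** Split off the last sign of a facet [(s, e)] of [S_(k+1)]: for [e = 0] the
    maximal faces of [M(bd T_k)] have [d - 1] zeros; for [e = -1] they are the
    facets of [S_k] outside [M(T_k)]; for [e = +1] they are the maximal faces of
    [M(T_k)], which have [d] zeros because [T_k] is pure. Since [T_k] is a cone
    over a complex of dimension [d - 2], its faces with [d] vertices all contain
    the apex, so that for [e = -1] membership in [T_k] matters only right after a
    zero entry; induction on [k] yields the list of types.

    Purity is the only topological input. A maximal simplex with [j + 1 <= k]
    vertices of a complex homeomorphic to the [k]-ball gives an embedding [h] of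
    a [k]-cube into [R^j]. The coordinates of its inverse are approximated by
    Lipschitz functions [g]; as [j < k], the image of [g] misses a neighbourhood
    of some point [p] in the cube, whereas [g o h - p] is close to a translate of
    the identity and therefore has approximate zeros, by Kuhn's cubical form of
    Sperner's lemma. *)

(** * Kuhn's lemma *)

Section KuhnLemma.
Local Open Scope ring_scope.
Variable k : nat.
Local Notation point := {ffun 'I_k -> nat}.
Local Notation form := ({set 'I_k} -> point -> 'F_2).

Definition upd (v : point) i a : point := [ffun j => if j == i then a else v j].
Definition step (v : point) i : point := upd v i (v i).+1.

(* Differential forms mod 2 on the grid: [w S] is the coefficient of the product
   of the directions in [S]. Evaluating [w] at the shifted point in [wedge] is
   what makes the Leibniz rule [extM] exact. *)
Definition wedge (f : point -> 'F_2) (w : form) : form := fun S v =>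
  \sum_(i in S) (f (step v i) - f v) * w (S :\ i) (step v i).
Definition ext (w : form) : form := fun S v =>
  \sum_(i in S) (w (S :\ i) (step v i) - w (S :\ i) v).
(** The product mod 2 of the differentials of the functions in [fs]; the empty product is the
    constant 1 in degree 0. *)
Fixpoint wedges (fs : seq (point -> 'F_2)) : form :=
  if fs is f :: fs' then wedge f (wedges fs') else fun S _ => (S == set0)%:R.

Lemma updC v i j a b : i != j -> upd (upd v i a) j b = upd (upd v j b) i a.
Proof.
move=> ij; apply/ffunP=> l; rewrite !ffunE.
by case: eqP => // ->; rewrite eq_sym (negbTE ij).
Qed.

Lemma upd_id v i a b : upd (upd v i a) i b = upd v i b.
Proof. by apply/ffunP=> l; rewrite !ffunE; case: eqP. Qed.

Lemma upd_at v i a : upd v i a i = a.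
Proof. by rewrite ffunE eqxx. Qed.

Lemma upd_other v i j a : j != i -> upd v i a j = v j.
Proof. by rewrite ffunE => /negbTE->. Qed.

Lemma stepC v i j : step (step v i) j = step (step v j) i.
Proof.
have [-> //|ij] := eqVneq i j.
by rewrite /step !ffunE (negbTE ij) eq_sym (negbTE ij) updC.
Qed.

Lemma addF2 (x : 'F_2) : x + x = 0.
Proof. by rewrite addrr_pchar2 // pchar_Fp. Qed.

(** The terms at [(i, j)] and [(j, i)] cancel mod 2. *)
Lemma sum_sym_offdiag (S : {set 'I_k}) (A : 'I_k -> 'I_k -> 'F_2) :
  (forall i j, A i j = A j i) -> \sum_(i in S) \sum_(j in S :\ i) A i j = 0.
Proof.
move=> sA; under eq_bigr => i _ do
  rewrite (bigID (fun j : 'I_k => (j < i)%N)) /=.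
rewrite big_split /= -[RHS](addF2 (\sum_(i in S) \sum_(j in S :\ i | (j < i)%N) A i j)).
congr (_ + _).
rewrite (exchange_big_dep (mem S)) /=; last first.
  by move=> i j _; rewrite !inE => /andP[/andP[]].
apply: eq_bigr => j jS; apply: eq_big => [i|i _]; last exact: sA.
rewrite !inE jS andbT -leqNgt ltn_neqAle (eq_sym j i) -(inj_eq val_inj) /=.
by case: (i \in S); case: (_ == _); rewrite ?andbF.
Qed.

Lemma extM (f : point -> 'F_2) (w : form) S v :
  ext (fun S v => f v * w S v) S v = wedge f w S v + f v * ext w S v.
Proof.
rewrite /ext /wedge mulr_sumr -big_split /=; apply: eq_bigr => i _.
by rewrite mulrBl mulrBr addrA subrK.
Qed.

Lemma ext_ext w S v : ext (ext w) S v = 0.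
Proof.
pose A i j := w (S :\ i :\ j) (step (step v i) j) - w (S :\ i :\ j) (step v i)
  - (w (S :\ i :\ j) (step v j) - w (S :\ i :\ j) v).
rewrite -(@sum_sym_offdiag S A) => [|i j].
  by apply: eq_bigr => i _; rewrite -sumrB.
have sd : S :\ i :\ j = S :\ j :\ i by rewrite !setDDl setUC.
by rewrite /A stepC sd; ring.
Qed.

(** By the Leibniz rule and induction, [wedge f (wedges fs)] is the [ext] of [f] times [wedges fs],
    and [ext] squares to zero. *)
Lemma wedges_closed fs S v : ext (wedges fs) S v = 0.
Proof.
elim: fs S v => [|f fs IH] S v /=.
  by rewrite /ext big1 // => i _; rewrite subrr.
rewrite -[RHS](ext_ext (fun S v => f v * wedges fs S v) S v).
by apply: eq_bigr => i _; rewrite !extM !IH !mulr0 !addr0.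
Qed.

(** * Sums over grid boxes and a discrete Stokes theorem *)

Variable M : nat.

Fixpoint Int (s : seq 'I_k) (g : point -> 'F_2) (v : point) : 'F_2 :=
  if s is i :: s' then \sum_(a < M) Int s' g (upd v i a) else g v.

Lemma eq_Int s g g' v : g =1 g' -> Int s g v = Int s g' v.
Proof. by move=> e; elim: s v => //= i s IH v; apply: eq_bigr => a _. Qed.

Lemma Int_sum s (I : finType) (P : pred I) (g : I -> point -> 'F_2) v :
  Int s (fun u => \sum_(a | P a) g a u) v = \sum_(a | P a) Int s (g a) v.
Proof.
elim: s v => //= i s IH v; rewrite exchange_big /=.
by apply: eq_bigr => a _.
Qed.

Lemma Int0 s v : Int s (fun=> 0) v = 0.
Proof. by elim: s v => //= i s IH v; rewrite big1. Qed.

Lemma Int_upd s g v i a : i \notin s ->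
  Int s (fun u => g (upd u i a)) v = Int s g (upd v i a).
Proof.
elim: s v => //= j s IH v; rewrite inE negb_or => /andP[ij is_].
by apply: eq_bigr => b _; rewrite IH // updC // eq_sym.
Qed.

Lemma Int_rem s g v i : uniq s -> i \in s ->
  Int s g v = Int (rem i s) (fun u => \sum_(a < M) g (upd u i a)) v.
Proof.
elim: s v => //= j s IH v /andP[js us]; rewrite inE.
have [->|ij] /= := eqVneq i j.
  by move=> _; rewrite Int_sum; apply: eq_bigr => a _; rewrite Int_upd.
by move=> is_; apply: eq_bigr => a _; rewrite IH.
Qed.

Lemma Int_step s g v i : uniq s -> i \in s ->
  Int s (fun u => g (step u i) - g u) v =
  Int (rem i s) (fun u => g (upd u i M) - g (upd u i 0)) v.
Proof.
move=> us is_; rewrite (Int_rem _ _ us is_); apply: eq_Int => u.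
rewrite -(telescope_sumr (fun a => g (upd u i a))) // big_mkord.
by apply: eq_bigr => a _; rewrite /step upd_id upd_at.
Qed.

(** Each summand of [ext] telescopes in its own direction and leaves two opposite faces of the
    box. *)
Lemma Stokes s w v : uniq s -> Int s (ext w [set:: s]) v =
  \sum_(i <- s) Int (rem i s)
    (fun u => w ([set:: s] :\ i) (upd u i M) - w ([set:: s] :\ i) (upd u i 0)) v.
Proof.
move=> us; rewrite /ext Int_sum big_uniq //=.
apply: eq_big => [i|i]; rewrite inE // => is_.
exact: (Int_step (w ([set:: s] :\ i))).
Qed.

(** Since [i] is not in [S], all steps taken by the product stay in the hyperplane where coordinate
    [i] is [a]; there [f] is constant and contributes a zero factor. *)
Lemma wedges_const fs (f : point -> 'F_2) i a (S : {set 'I_k}) (u : point) :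
  (forall x y : point, x i = a -> y i = a -> f x = f y) ->
  i \notin S -> u i = a -> List.In f fs -> wedges fs S u = 0.
Proof.
move=> cf; elim: fs S u => //= g fs IH S u iS ua fin.
rewrite /wedge big1 // => j jS.
have ji : step u j i = a.
  by rewrite upd_other //; apply: contraNneq iS => ->.
case: fin => [->|fin]; first by rewrite (cf _ u) // subrr mul0r.
by rewrite (IH (S :\ j)) ?mulr0 // !inE (negbTE iS) andbF.
Qed.

(* By Stokes, only the face [d = M] of the box contributes: [f d] vanishes on the
   face [d = 0], and on the faces normal to another direction [i] the function
   [f i] is constant. *)
Lemma Int_wedges (f : 'I_k -> point -> 'F_2) s v :
  (forall i (u : point), u i = 0%N -> f i u = 0) ->
  (forall i (u : point), u i = M -> f i u = 1) ->
  uniq s -> Int s (wedges (map f s) [set:: s]) v = 1.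
Proof.
move=> f0 fM; elim: s v => [|d s IH] v.
  by move=> _ /=; rewrite set_nil eqxx.
move=> us; have /andP[ds us'] := us.
set S := [set:: d :: s].
have -> : Int (d :: s) (wedges (map f (d :: s)) S) v =
    Int (d :: s) (ext (fun S v => f d v * wedges (map f s) S v) S) v.
  by apply: eq_Int => u /=; rewrite extM wedges_closed mulr0 addr0.
rewrite Stokes // big_cons -/S big_seq big1 => [|i is_].
  rewrite addr0 -[RHS](IH (upd v d M) us') /= eqxx -Int_upd //.
  apply: eq_Int => u; rewrite fM ?upd_at // f0 ?upd_at // mul0r subr0 mul1r.
  congr (wedges _ _ _); apply/setP=> i; rewrite !inE.
  by have [->|] := eqVneq i d; rewrite ?(negbTE ds).
have iin : List.In (f i) (map f s).
  elim: (s) is_ => //= j s' IHs; rewrite inE => /orP[/eqP->|/IHs]; by [left|right].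
rewrite -[RHS](Int0 (rem i (d :: s)) v); apply: eq_Int => u.
rewrite (@wedges_const _ (f i) i M) ?upd_at ?inE ?eqxx //.
  rewrite (@wedges_const _ (f i) i 0%N) ?upd_at ?inE ?eqxx // ?mulr0 ?subrr //.
  by move=> x y xi yi; rewrite !f0.
by move=> x y xi yi; rewrite !fM.
Qed.

Lemma Int_neq0 s g v : Int s g v != 0 ->
  exists u : point, (forall i, i \in s -> (u i < M)%N) /\ g u != 0.
Proof.
(* Keeping track of the coordinates outside [s] ensures that the value chosen for one direction
   survives the remaining sums. *)
suff H : Int s g v != 0 -> exists u : point, [/\ forall i, i \in s -> (u i < M)%N,
    forall i, i \notin s -> u i = v i & g u != 0].
  by move=> /H[u [h1 _ h3]]; exists u.
elim: s v => [|i s IH] v /=; first by exists v.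
move=> nz; have [a na] : exists a : 'I_M, Int s g (upd v i a) != 0.
  apply/existsP; apply: contraNT nz; rewrite negb_exists => /forallP h.
  by rewrite big1 // => a _; apply/eqP; rewrite -[_ == _]negbK h.
have [u [h1 h2 h3]] := IH _ na; exists u; split=> // j; rewrite inE.
  case: (boolP (j \in s)) => [/h1 //|/h2 ->]; rewrite orbF => /eqP->.
  by rewrite upd_at.
by rewrite negb_or => /andP[ji /h2 ->]; rewrite upd_other.
Qed.

(** A nonzero coefficient contains a nonzero product of differences, one for each function, along a
    monotone path of edges of the cell at [u] spanned by [S]. *)
Lemma wedges_neq0 fs S u : wedges fs S u != 0 ->
  forall f, List.In f fs -> exists x y : point,
    [/\ forall j, (u j <= x j <= u j + (j \in S))%N,
        forall j, (u j <= y j <= u j + (j \in S))%N & f x != f y].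
Proof.
elim: fs S u => //= g fs IH S u nz f fin.
have [j jS nzj] : exists2 j, j \in S &
    (g (step u j) - g u) * wedges fs (S :\ j) (step u j) != 0.
  apply/exists_inP; apply: contraNT nz; rewrite negb_exists_in => /forall_inP h.
  by rewrite /wedge big1 // => j /h; rewrite negbK => /eqP.
move: nzj; rewrite mulf_eq0 negb_or subr_eq0 => /andP[n1 n2].
have inS (x : point) :
    (forall l, (step u j l <= x l <= step u j l + (l \in S :\ j))%N) ->
    forall l, (u l <= x l <= u l + (l \in S))%N.
  move=> hx l; move: (hx l); rewrite /step !inE.
  have [->|lj] := eqVneq l j; last by rewrite upd_other.
  rewrite upd_at jS addn0 addn1 => /andP[h1 h2].
  by rewrite h2 andbT (leq_trans _ h1).
case: fin => [<-|fin].
  exists (step u j), u; split=> // l; last by rewrite leqnn leq_addr.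
  by apply: inS => i; rewrite leqnn leq_addr.
have [x [y [hx hy xy]]] := IH _ _ n2 _ fin.
by exists x, y; split=> //; apply: inS.
Qed.

(** The product of the differentials of the labels has sum 1 over the box, so it is nonzero at some
    cell, and every label changes on that cell. *)
Lemma Kuhn (l : 'I_k -> point -> bool) :
  (forall i (u : point), u i = 0%N -> ~~ l i u) ->
  (forall i (u : point), u i = M -> l i u) ->
  exists u : point, (forall i, u i < M)%N /\
    forall i, exists x y : point, [/\ forall j, (u j <= x j <= (u j).+1)%N,
        forall j, (u j <= y j <= (u j).+1)%N, l i x & ~~ l i y].
Proof.
move=> l0 lM; pose f i u : 'F_2 := (l i u)%:R.
have [] := @Int_neq0 (enum 'I_k) (wedges (map f (enum 'I_k)) [set:: enum 'I_k])
  [ffun=> 0%N].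
  rewrite Int_wedges ?oner_eq0 ?enum_uniq // /f => i u ui.
    by rewrite (negbTE (l0 _ _ ui)).
  by rewrite lM.
move=> u [uM nz]; exists u; split=> i; first by rewrite uM ?mem_enum.
have [|x [y [hx hy]]] := wedges_neq0 nz (f := f i).
  have : i \in enum 'I_k by rewrite mem_enum.
  elim: (enum 'I_k) => //= j s' IHs; rewrite inE => /orP[/eqP->|/IHs]; by [left|right].
have wd (z : point) : (forall j, u j <= z j <= u j + (j \in [set:: enum 'I_k]))%N ->
    (forall j, u j <= z j <= (u j).+1)%N.
  by move=> h j; move: (h j); rewrite inE mem_enum addn1.
rewrite /f; case lx : (l i x); case ly : (l i y); rewrite ?eqxx // => _.
  by exists x, y; rewrite lx ly; split=> //; apply: wd.
by exists y, x; rewrite lx ly; split=> //; apply: wd.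
Qed.

End KuhnLemma.

(** * A cube does not embed in a space of lower dimension *)

From mathcomp Require Import boolp classical_sets reals topology normedtype.
Import numFieldNormedType.Exports.

Section Dimension.
Local Open Scope ring_scope.
Variable R : realType.

Lemma rV_norm_leP n (x : 'rV[R]_n) e : 0 <= e ->
  `|x| <= e <-> forall i, `|x ord0 i| <= e.
Proof.
move=> e0; rewrite [`|x|]/Num.Def.normr /= mx_normrE; split=> [h i|h].
  by apply: le_trans h; exact: (le_bigmax _ _ (ord0, i)).
by apply: bigmax_le => // -[i j] _ /=; rewrite ord1.
Qed.

Lemma rV_norm_ge n (x : 'rV[R]_n) i : `|x ord0 i| <= `|x|.
Proof. exact: (rV_norm_leP x (normr_ge0 x)).1. Qed.

Lemma nat_gt (x : R) : exists2 n : nat, (0 < n)%N & x < n%:R.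
Proof.
exists (Num.Def.archi_bound `|x|).+1 => //.
rewrite (le_lt_trans (ler_norm x)) // (lt_trans (archi_boundP _)) //.
by rewrite ltr_nat.
Qed.

Lemma leq_minS (a b c : nat) : (a <= b.+1)%N -> (minn a c <= (minn b c).+1)%N.
Proof. lia. Qed.

Lemma leq_min2r (a b c : nat) : (a <= b)%N -> (minn a c <= minn b c)%N.
Proof. lia. Qed.

Definition unit_cube n (x : 'rV[R]_n) := forall i, 0 <= x ord0 i <= 1.

(** Pigeonhole: Kuhn's lemma gives for each of [P ^ k] targets a point in the image of [h]. Targets
    whose points share one of [(N + 1) ^ j] cells coincide, and there are too few cells. *)
Lemma cube_no_low_dim k j (h : 'rV[R]_k -> 'rV[R]_j) (delta : R) : (j < k)%N ->
  (forall x, unit_cube x -> unit_cube (h x)) -> 0 < delta ->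
  (forall x y, unit_cube x -> unit_cube y -> `|h x - h y| < delta ->
     `|x - y| <= 1 / 4) ->
  (forall e : R, 0 < e -> exists2 eta : R, 0 < eta & forall x y,
     unit_cube x -> unit_cube y -> `|x - y| < eta -> `|h x - h y| < e) ->
  False.
Proof.
move=> jk h01 delta0 hinv hcont.
have [L [L0 dL]] : exists L : nat, (0 < L)%N /\ 1 <= L%:R * delta.
  have [L L0 dL] := nat_gt delta^-1; exists L; split=> //.
  by rewrite -ler_pdivrMr // div1r ltW.
(* These sizes give [(N + 1) ^ j <= (13 * L * P) ^ j < P ^ (j + 1) <= P ^ k]. *)
pose P := ((13 * L) ^ j).+1; pose N := (12 * L * P)%N.
have N0 : (0 < N)%N by rewrite /N; lia.
have P0R : 0 < P%:R :> R by rewrite ltr0n.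
have N0R : 0 < N%:R :> R by rewrite ltr0n.
have L0R : 0 < L%:R :> R by rewrite ltr0n.
have [|eta eta0 heta] := hcont N%:R^-1; first by rewrite invr_gt0.
have [M [M0 Meta]] : exists M : nat, (0 < M)%N /\ M%:R^-1 < eta.
  have [M M0 hM] := nat_gt eta^-1; exists M; split=> //.
  by rewrite invf_plt ?posrE // ltr0n.
have M0R : 0 < M%:R :> R by rewrite ltr0n.
pose pos (u : {ffun 'I_k -> nat}) : 'rV[R]_k :=
  \row_i ((minn (u i) M)%:R / M%:R).
have posE u i : pos u ord0 i = (minn (u i) M)%:R / M%:R by rewrite mxE.
have pos01 u : unit_cube (pos u).
  move=> i; rewrite posE divr_ge0 ?ler0n //= ler_pdivrMr // mul1r ler_nat.
  exact: geq_minr.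
pose pt (v : {ffun 'I_k -> 'I_M.+1}) := pos [ffun i => v i : nat].
(* An [L]-Lipschitz approximation of the [i]-th coordinate of the inverse of [h]. *)
pose g i y := \big[Order.max/0]_(v : {ffun 'I_k -> 'I_M.+1})
  (pt v ord0 i - L%:R * `|y - h (pt v)|).
have g_lip i y z : g i y <= g i z + L%:R * `|y - z|.
  have gz0 : 0 <= g i z by exact: bigmax_ge_id.
  have Lyz : 0 <= L%:R * `|y - z| by rewrite mulr_ge0 // ltW.
  apply: bigmax_le => [|v _]; first by rewrite addr_ge0.
  have gv : pt v ord0 i - L%:R * `|z - h (pt v)| <= g i z.
    exact: (le_bigmax _ (fun v => pt v ord0 i - L%:R * `|z - h (pt v)|)).
  have tri : L%:R * `|z - h (pt v)| <= L%:R * `|y - z| + L%:R * `|y - h (pt v)|.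
    rewrite -mulrDr ler_pM2l // (distrC y z).
    have -> : z - h (pt v) = (z - y) + (y - h (pt v)) by rewrite addrA subrK.
    exact: ler_normD.
  lra.
have g_ge i u : pos u ord0 i <= g i (h (pos u)).
  pose v : {ffun 'I_k -> 'I_M.+1} := [ffun i => inord (minn (u i) M)].
  have vu : pt v = pos u.
    apply/rowP => l; rewrite !mxE !ffunE inordK ?ltnS ?geq_minr //.
    by rewrite (minn_idPl _) // geq_minr.
  have := le_bigmax 0 (fun v => pt v ord0 i - L%:R * `|h (pos u) - h (pt v)|) v.
  by rewrite vu subrr normr0 mulr0 subr0.
(* A grid point whose image is closer than [delta] has a coordinate larger by at most 1/4; for the
   others [L * delta >= 1] makes the term nonpositive. *)
have g_le i u : g i (h (pos u)) <= pos u ord0 i + 1 / 4.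
  have /andP[p0 _] := pos01 u i.
  apply: bigmax_le => [|v _]; first by lra.
  have /andP[_ q1] := pos01 [ffun i => v i : nat] i; rewrite -/(pt v) in q1.
  have [lt|ge] := ltP `|h (pos u) - h (pt v)| delta.
    have := hinv _ _ (pos01 _) (pos01 _) lt => /(le_trans (rV_norm_ge _ i)).
    rewrite !mxE -!posE -/(pt v) ler_norml => /andP[le _].
    have : 0 <= L%:R * `|h (pos u) - h (pt v)| by rewrite mulr_ge0 // ltW.
    by move: le; rewrite -/pt; lra.
  have : L%:R * delta <= L%:R * `|h (pos u) - h (pt v)| by rewrite ler_pM2l.
  lra.
(* The targets must lie in [[1/4, 1)] because [g i] is at most 1/4 on the face [u i = 0] and at
   least 1 on the face [u i = M]. *)
pose p (w : {ffun 'I_k -> 'I_P}) i : R := 1 / 4 + (w i)%:R / (4 * P%:R).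
have p_bd w i : 1 / 4 <= p w i < 1.
  rewrite /p lerDl divr_ge0 ?mulr_ge0 ?ler0n //=.
  have : (w i)%:R / (4 * P%:R) <= 1 / 4 :> R.
    rewrite ler_pdivrMr ?mulr_gt0 ?ltr0n //.
    have : (w i)%:R <= P%:R :> R by rewrite ler_nat ltnW.
    lra.
  lra.
have LN : L%:R / N%:R = 1 / (12 * P%:R) :> R.
  by rewrite /N !natrM; field; rewrite !gt_eqF.
(* The [P ^ k] targets [p w] are [1 / (4 P) = 3 L / N] apart, while two grid
   points in a common cell of side [1 / N] have [g]-values within [L / N]. *)
have near_target w : exists u : {ffun 'I_k -> nat}, forall i,
    `|g i (h (pos u)) - p w i| < 1 / (12 * P%:R).
  have [||u [uM hu]] := @Kuhn k M (fun i u => p w i < g i (h (pos u))).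
  - move=> i u ui; rewrite -leNgt (le_trans (g_le _ _)) // posE ui min0n mul0r add0r.
    by have /andP[] := p_bd w i.
  - move=> i u ui; rewrite (lt_le_trans _ (g_ge i u)) // posE ui minnn divff ?gt_eqF //.
    by have /andP[] := p_bd w i.
  (* In the cell of [u], the values of [g i] at [x] and [y] lie on opposite sides of [p w i]; the
     Lipschitz bound puts the value at [u] within [L / N] of it. *)
  exists u => i; have [x [y [hx hy lx]]] := hu i; rewrite -leNgt => ly.
  have close (z : {ffun _ -> nat}) : (forall l, u l <= z l <= (u l).+1)%N ->
      L%:R * `|h (pos z) - h (pos u)| < 1 / (12 * P%:R).
    move=> hz; rewrite -LN ltr_pM2l //; apply: heta => //.
    apply: le_lt_trans Meta; apply/rV_norm_leP; first by rewrite invr_ge0 ltW.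
    have Mi : 0 <= M%:R^-1 :> R by rewrite invr_ge0 ltW.
    move=> l; rewrite !mxE -mulrBl normrM (ger0_norm Mi).
    rewrite ler_piMl // ger0_norm ?subr_ge0 ?ler_nat //.
      rewrite lerBlDr nat1r ler_nat.
      by have /andP[_ zu] := hz l; exact: leq_minS.
    by have /andP[uz _] := hz l; rewrite leq_min2r.
  rewrite ltr_norml; apply/andP; split.
    have := g_lip i (h (pos x)) (h (pos u)); have := close _ hx; lra.
  have := g_lip i (h (pos u)) (h (pos y)); rewrite distrC; have := close _ hy; lra.
have [q hq] := choice near_target.
pose cell w : {ffun 'I_j -> 'I_N.+1} :=
  [ffun a => inord (Num.Def.trunc (N%:R * h (pos (q w)) ord0 a))].
have cell_inj : injective cell.
  move=> w w' cww; apply/ffunP => i; apply/val_inj => /=.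
  have hd : L%:R * `|h (pos (q w)) - h (pos (q w'))| <= 1 / (12 * P%:R).
    rewrite -LN ler_pM2l //; apply/rV_norm_leP; first by rewrite invr_ge0 ltW.
    move=> a; rewrite !mxE -(ler_pM2l N0R) mulfV ?gt_eqF //.
    rewrite -[X in X * _](gtr0_norm N0R) -normrM mulrBr.
    have tr w0 : let t := N%:R * h (pos (q w0)) ord0 a in
        (cell w0 a)%:R <= t < (cell w0 a).+1%:R.
      rewrite /= ffunE; have /andP[a0 a1] := h01 _ (pos01 (q w0)) a.
      have t0 : 0 <= N%:R * h (pos (q w0)) ord0 a by rewrite mulr_ge0 // ltW.
      rewrite inordK ?truncn_itv // ltnS -(ler_nat R).
      have /andP[le _] := truncn_itv t0; rewrite (le_trans le) //.
      by rewrite ler_piMr // ltW.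
    have /andP[] := tr w; have /andP[] := tr w'; rewrite cww -!natr1.
    by rewrite ler_norml; move=> *; apply/andP; split; lra.
  have c1 := hq w i; have c2 := hq w' i.
  have l1 := g_lip i (h (pos (q w))) (h (pos (q w'))).
  have l2 := g_lip i (h (pos (q w'))) (h (pos (q w))); rewrite distrC in l2.
  (* Two approximation errors plus the variation of [g i] between the two image points. *)
  have : `|p w i - p w' i| < 3 * (1 / (12 * P%:R)).
    move: c1 c2; rewrite !ltr_norml => /andP[? ?] /andP[? ?]; apply/andP; split; lra.
  rewrite /p opprD addrACA subrr add0r -mulrBl normrM.
  rewrite (gtr0_norm (x := (4 * P%:R)^-1)) ?invr_gt0 ?mulr_gt0 //.
  have -> : 3 * (1 / (12 * P%:R)) = 1 / (4 * P%:R) :> R by field; rewrite gt_eqF.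
  rewrite ltr_pM2r ?invr_gt0 ?mulr_gt0 // ltr_norml => /andP[].
  rewrite ltrNl opprB !ltrBlDr !nat1r !ltr_nat !ltnS => ? ?.
  by apply/eqP; rewrite eqn_leq; apply/andP.
have := leq_card _ cell_inj; rewrite !card_ffun !card_ord leqNgt => /negP; apply.
apply: (@leq_trans (P ^ j.+1)); last by rewrite leq_pexp2l.
rewrite expnS; apply: (@leq_ltn_trans ((13 * L) ^ j * P ^ j)).
  by rewrite -expnMn; case: (j) => // j'; rewrite leq_exp2r // /N; lia.
by rewrite ltn_pmul2r ?expn_gt0.
Qed.

End Dimension.

(** * Purity of simplicial balls *)

Section Balls.
Local Open Scope ring_scope.
Local Open Scope classical_set_scope.
Variable R : realType.

(** * Uniform continuity and compactness *)

Lemma within_continuous_dist (U V : normedModType R) (A : set U) (f : U -> V) :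
  {within A, continuous f} -> forall x, A x -> forall e : R, 0 < e ->
  exists2 d : R, 0 < d & forall y, A y -> `|x - y| < d -> `|f x - f y| < e.
Proof.
move=> /subspace_continuousP cf x Ax e e0.
have /cvgrPdist_lt/(_ e e0) := cf x Ax.
move=> /nbhs_ballP[d d0 hd]; exists d => // y Ay xy.
by apply: hd => //; rewrite -ball_normE.
Qed.

Lemma Heine_Cantor (U V : normedModType R) (A : set U) (f : U -> V) :
  compact A -> {within A, continuous f} -> forall e : R, 0 < e ->
  exists2 d : R, 0 < d & forall x y, A x -> A y -> `|x - y| < d -> `|f x - f y| < e.
Proof.
move=> /compact_near_coveringP cA cf e e0.
(* Compactness in near-covering form, applied to radii [d] tending to 0 from the right. *)
have := cA R 0^'+ (fun d x =>
  forall y, A y -> A x -> `|x - y| < d -> `|f x - f y| < e) _.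
case=> [x Ax|d /= d0 hd].
  have e2 : 0 < e / 2 by rewrite divr_gt0.
  have [d d0 hd] := within_continuous_dist cf Ax e2.
  exists (ball x (d / 2), [set r | r < d / 2]).
    split; first by apply: nbhsx_ballx; rewrite divr_gt0.
    by apply: nbhs_right_lt; rewrite divr_gt0.
  move=> [z r] /= [xz rd] y Ay Az zy; rewrite -ball_normE /= in xz.
  have h1 := hd _ Az; have h2 := hd _ Ay.
  have fzy : `|f z - f y| <= `|f x - f z| + `|f x - f y|.
    have -> : f z - f y = (f z - f x) + (f x - f y) by rewrite addrA subrK.
    by rewrite (distrC (f x) (f z)) ler_normD.
  have xy : `|x - y| <= `|x - z| + `|z - y|.
    have -> : x - y = (x - z) + (z - y) by rewrite addrA subrK.
    exact: ler_normD.
  have := h1 _; have := h2 _; lra.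
(* [hd] speaks of radii strictly between 0 and [d]. *)
exists (d / 2); first by rewrite divr_gt0.
move=> x y Ax Ay xy; apply: (hd (d / 2)) => //=.
  by rewrite sub0r normrN gtr0_norm ?divr_gt0 //; lra.
by rewrite divr_gt0.
Qed.

Lemma closed_unit_ball_coord k (x : 'rV[R]_k) i :
  closed_unit_ball x -> `|x ord0 i| <= 1.
Proof.
rewrite /closed_unit_ball /= => h; rewrite -(expr_le1 (n := 2)) //.
apply: le_trans h; rewrite (bigD1 i) //= real_normK ?num_real // lerDl.
by apply: sumr_ge0 => j _; rewrite sqr_ge0.
Qed.

Lemma closed_unit_ball_compact k : compact (@closed_unit_ball R k).
Proof.
apply: bounded_closed_compact.
  exists 1; split=> [|e e1 x bx]; first exact: num_real.
  apply/rV_norm_leP; first by lra.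
  by move=> i; rewrite (le_trans (closed_unit_ball_coord i bx)) // ltW.
have -> : @closed_unit_ball R k =
    (fun x : 'rV[R]_k => \sum_i x ord0 i ^+ 2) @^-1` [set r : R | r <= 1] by [].
apply: preimage_closed; last exact: closed_le.
move=> x _.
apply: (@cvg_big R 'I_k +%R 0 xpredT (@add_continuous R^o) 'rV[R]_k (nbhs x)
  (index_enum _) (fun i y => y ord0 i ^+ 2) (fun i => x ord0 i ^+ 2)) => i _.
by apply: cvgM; exact: coord_continuous.
Qed.

Lemma geometric_realization_coord m (D : {set {set 'I_m}}) (x : 'rV[R]_m) i :
  geometric_realization D x -> 0 <= x ord0 i <= 1.
Proof.
case=> x0 xs _; rewrite x0 /= -xs (bigD1 i) //= lerDl.
by apply: sumr_ge0.
Qed.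

(** Otherwise [F] has at most [k] vertices. By maximality the points near its barycenter are
    supported on [F], so at most [k - 1] coordinates determine them, although they correspond to a
    neighbourhood in the [k]-ball; [cube_no_low_dim] excludes this. *)
Lemma ball_maximal_face k m (D : {set {set 'I_m}}) (F : {set 'I_m}) :
  simplicial_ball R k D -> F \in D ->
  (forall G : {set 'I_m}, G \in D -> F \subset G -> G = F) -> (k < #|F|)%N.
Proof.
case=> -[_ Dsub] [f [g [[cf cg] fB gD gK fK]]] FD Fmax.
rewrite ltnNge; apply/negP => Fk.
have supp_F (z : 'rV[R]_m) : geometric_realization D z ->
    (forall i, i \in F -> z ord0 i != 0) -> forall i, i \notin F -> z ord0 i = 0.
  case=> _ _ zD zF i; rewrite -{1}(Fmax _ zD) ?inE ?negbK => [/eqP //|].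
  by apply/fintype.subsetP => l lF; rewrite inE zF.
have Fn0 : (0 < #|F|)%N.
  (* For empty [F], all coordinates of the point [g 0] would vanish, against their sum being 1. *)
  rewrite lt0n cards_eq0; apply/eqP => F0.
  have B0 : closed_unit_ball (0 : 'rV[R]_k).
    rewrite /closed_unit_ball /= big1 // => i _; by rewrite mxE expr0n.
  have [_ s1 _] := gD _ B0; move: s1; rewrite big1 => [/eqP|i _].
    by rewrite eq_sym oner_eq0.
  by apply: (supp_F _ (gD _ B0)); rewrite F0 ?inE // => l; rewrite inE.
have [i0 i0F] := card_gt0P Fn0.
have F0R : 0 < #|F|%:R :> R by rewrite ltr0n.
(* Near the barycenter [x0] of [F] the realization consists of points with
   support exactly [F]; [y] maps the unit cube into the corresponding part of
   the ball, and dropping the redundant coordinate [i0] gives [h]. *)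
pose x0 : 'rV[R]_m := \row_i (if i \in F then #|F|%:R^-1 else 0).
have Dx0 : geometric_realization D x0.
  split=> [i||].
  - by rewrite mxE; case: ifP => // _; rewrite invr_ge0 ltW.
  - under eq_bigr do rewrite mxE.
    rewrite -big_mkcond /= sumr_const -[X in X *+ _]mul1r -mulrnAr -mulr_natr.
    by rewrite mulVf ?mulr1 // gt_eqF.
  - rewrite (_ : [set i | _]%SET = F) //; apply/setP => i; rewrite inE mxE.
    by case: ifP; rewrite ?eqxx // invr_eq0 gt_eqF.
pose p := f x0; have Bp : closed_unit_ball p by exact: fB.
have [|d0 d00 hd0] := within_continuous_dist cg Bp (e := #|F|%:R^-1).
  by rewrite invr_gt0.
have near_F y : closed_unit_ball y -> `|p - y| < d0 ->
    forall i, i \notin F -> g y ord0 i = 0.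
  move=> By py; apply: supp_F; first exact: gD.
  move=> i iF; have := hd0 y By py; rewrite gK // => /(le_lt_trans (rV_norm_ge _ i)).
  rewrite !mxE iF; case: eqP => // ->.
  by rewrite subr0 gtr0_norm ?invr_gt0 // ltxx.
have k0 : (0 < k)%N by rewrite (leq_trans Fn0).
have k0R : 0 < k%:R :> R by rewrite ltr0n.
have k1R : 1 <= k%:R :> R by rewrite ler1n.
(* The first bound keeps [1 - eta] positive, the second gives [2 * eta < d0], where [2 * eta] bounds
   the distance from [p] to [y x]. *)
pose eta : R := Num.min (1 / 2) (d0 / 3).
have eta0 : 0 < eta by rewrite lt_min !divr_gt0.
have eta1 : eta <= 1 / 2 by rewrite ge_min lexx.
have etad : eta <= d0 / 3 by rewrite ge_min lexx orbT.
(* A convex combination of [p] and [x / k], which lies in the ball when [x] is in the unit cube. *)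
pose y (x : 'rV[R]_k) : 'rV[R]_k := (1 - eta) *: p + (eta / k%:R) *: x.
have ek0 : 0 < eta / k%:R by rewrite divr_gt0.
have ek1 : eta / k%:R <= 1.
  by rewrite ler_pdivrMr // mul1r; lra.
have yB x : unit_cube x -> closed_unit_ball (y x).
  move=> x01; rewrite /closed_unit_ball /=.
  have le i : (y x) ord0 i ^+ 2 <= (1 - eta) * p ord0 i ^+ 2 + eta * k%:R^-1.
    rewrite !mxE; have /andP[xi0 xi1] := x01 i.
    set b := x ord0 i / k%:R.
    have -> : eta / k%:R * x ord0 i = eta * b by rewrite /b; ring.
    have b0 : 0 <= b by rewrite divr_ge0 // ltW.
    have bk : b <= k%:R^-1 by rewrite /b ler_piMl // invr_ge0 ltW.
    have ki1 : k%:R^-1 <= 1 :> R by rewrite invf_le1.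
    have bb : b ^+ 2 <= k%:R^-1.
      by rewrite expr2 (le_trans _ bk) // ler_piMr // (le_trans bk).
    have c1 : 0 <= eta * (1 - eta) * (p ord0 i - b) ^+ 2.
      by rewrite mulr_ge0 ?sqr_ge0 // mulr_ge0 //; lra.
    have c2 : eta * b ^+ 2 <= eta * k%:R^-1 by rewrite ler_pM2l.
    move: (p ord0 i) c1 => a c1.
    have : (1 - eta) * a ^+ 2 + eta * b ^+ 2 - ((1 - eta) * a + eta * b) ^+ 2
        = eta * (1 - eta) * (a - b) ^+ 2 by ring.
    lra.
  apply: le_trans (ler_sum _ (fun i _ => le i)) _.
  rewrite big_split /= -mulr_sumr sumr_const card_ord.
  rewrite -mulrnAr -mulr_natr mulVf ?gt_eqF // mulr1.
  have : (1 - eta) * \sum_i p ord0 i ^+ 2 <= (1 - eta) * 1.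
    by rewrite ler_wpM2l //; lra.
  lra.
have yp x : unit_cube x -> `|p - y x| < d0.
  move=> x01; apply: (@le_lt_trans _ _ (2 * eta)); last by lra.
  apply/rV_norm_leP => [|i]; first by lra.
  rewrite !mxE; have /andP[xi0 xi1] := x01 i.
  have := closed_unit_ball_coord i Bp; rewrite !ler_norml => /andP[p1 p2].
  have q0 : 0 <= eta / k%:R * x ord0 i by rewrite mulr_ge0 // ltW.
  have q1 : eta / k%:R * x ord0 i <= eta.
    rewrite (le_trans (ler_piMr (ltW ek0) xi1)) //.
    by rewrite ler_pdivrMr // ler_peMr // ltW.
  have r1 : eta * p ord0 i <= eta by rewrite ler_piMr // ltW.
  have r2 : - eta <= eta * p ord0 i.
    by rewrite -{1}[eta]mulr1 -mulrN ler_pM2l.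
  by apply/andP; split; lra.
have yy x x' : y x - y x' = (eta / k%:R) *: (x - x').
  by rewrite /y opprD addrACA subrr add0r scalerBr.
pose j := #|F :\ i0|.
have jF : #|F| = j.+1 by rewrite (cardsD1 i0) i0F.
pose h x : 'rV[R]_j := \row_a g (y x) ord0 (enum_val a).
have hg x x' : `|h x - h x'| <= `|g (y x) - g (y x')|.
  apply/rV_norm_leP => // a; rewrite !mxE.
  by have := rV_norm_ge (g (y x) - g (y x')) (enum_val a); rewrite !mxE.
(* Coordinates outside [F] vanish at both points, and coordinate [i0] is recovered from the total
   sum 1, at the cost of a factor. *)
have gh x x' : unit_cube x -> unit_cube x' ->
    `|g (y x) - g (y x')| <= j.+1%:R * `|h x - h x'|.
  move=> x01 x01'.
  have gi i : i \in F :\ i0 -> `|(g (y x) - g (y x')) ord0 i| <= `|h x - h x'|.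
    move=> iF; have := rV_norm_ge (h x - h x') (enum_rank_in iF i).
    by rewrite !mxE enum_rankK_in.
  apply/rV_norm_leP => [|i]; first by rewrite mulr_ge0.
  have hle : `|h x - h x'| <= j.+1%:R * `|h x - h x'|.
    by rewrite ler_peMl // ler1n.
  have [iF|iF] := boolP (i \in F); last first.
    rewrite !mxE !near_F // ?subr0 ?normr0 ?mulr_ge0 //.
    - exact: yB.
    - exact: yp.
    - exact: yB.
    - exact: yp.
  have [ii0|ii0] := eqVneq i i0; last by rewrite (le_trans (gi i _)) // !inE ii0.
  have sum0 : \sum_l (g (y x) - g (y x')) ord0 l = 0.
    under eq_bigr do rewrite !mxE.
    have [_ s1 _] := gD _ (yB _ x01); have [_ s2 _] := gD _ (yB _ x01').
    by rewrite sumrB s1 s2 subrr.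
  have : (g (y x) - g (y x')) ord0 i =
      - \sum_(l in F :\ i0) (g (y x) - g (y x')) ord0 l.
    move: sum0; rewrite (bigD1 i) //= => /eqP; rewrite addr_eq0 => /eqP ->.
    congr (- _); rewrite (bigID (mem F)) /= [X in _ + X]big1 ?addr0.
      by apply: eq_bigl => l; rewrite !inE ii0.
    move=> l /andP[_ lF]; rewrite !mxE !near_F ?subr0 //.
    - exact: yB.
    - exact: yp.
    - exact: yB.
    - exact: yp.
  move=> ->; rewrite normrN (le_trans (ler_norm_sum _ _ _)) //.
  apply: le_trans (ler_sum _ gi) _; rewrite sumr_const -/j -[leLHS]mulr_natl.
  by rewrite ler_wpM2r // ler_nat.
have cD : compact (geometric_realization D : set 'rV[R]_m).
  have -> : geometric_realization D = g @` (@closed_unit_ball R k).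
    apply/seteqP; split=> [z Dz|_ [w Bw <-]]; last exact: gD.
    by exists (f z); [exact: fB|exact: gK].
  exact: continuous_compact cg (@closed_unit_ball_compact k).
(* As [y] scales distances by [eta / k], this precision becomes 1/4 on the cube. *)
have [|d1 d10 hd1] := Heine_Cantor cD cf (e := eta / k%:R / 4).
  by rewrite divr_gt0.
have j0R : 0 < j.+1%:R :> R by rewrite ltr0n.
apply: (@cube_no_low_dim R k j h (d1 / j.+1%:R)).
- by rewrite -jF.
- move=> x x01 a; rewrite mxE; apply: geometric_realization_coord.
  by apply: gD; exact: yB.
- by rewrite divr_gt0.
- move=> x x' x01 x01' hx.
  have : `|f (g (y x)) - f (g (y x'))| < eta / k%:R / 4.
    apply: hd1; try by apply: gD; exact: yB.
    by rewrite (le_lt_trans (gh _ _ x01 x01')) // mulrC -ltr_pdivlMr.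
  rewrite !fK; try exact: yB.
  rewrite yy normrZ gtr0_norm // ltr_pM2l // => /ltW; lra.
- move=> e e0; have [d d00' hd] := Heine_Cantor (@closed_unit_ball_compact k) cg e0.
  exists d => // x x' x01 x01' xx'; rewrite (le_lt_trans (hg _ _)) //.
  apply: hd; try exact: yB.
  rewrite yy normrZ gtr0_norm // (le_lt_trans _ xx') //.
  by rewrite ler_piMl.
Qed.

End Balls.

(** * Facets of the complexes [S_k] *)

Section Facets.
Local Open Scope set_scope.

Lemma append_surj k (s : k.+1.-tuple sign) : exists t e, s = append t e.
Proof.
case: s => s; case/lastP: s => [//|s e] sz.
have szs : size s == k by move: sz; rewrite size_rcons eqSS.
by exists (Tuple szs), e; apply: val_inj.
Qed.

Lemma tnth_append_old k (s : k.-tuple sign) e j :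
  tnth (append s e) (lift ord_max j) = tnth s j.
Proof.
by rewrite !(tnth_nth Zero) lift_max /= nth_rcons size_tuple ltn_ord.
Qed.

Lemma tnth_append_max k (s : k.-tuple sign) e : tnth (append s e) ord_max = e.
Proof. by rewrite (tnth_nth Zero) /= nth_rcons size_tuple ltnn eqxx. Qed.

Lemma append_inj k (s t : k.-tuple sign) e e' :
  append s e = append t e' -> s = t /\ e = e'.
Proof. by move=> /(congr1 val) /= /rcons_inj [/val_inj -> ->]. Qed.

Lemma mem_old_vertices m (F : {set 'I_m}) j :
  (lift ord_max j \in old_vertices F) = (j \in F).
Proof. by rewrite mem_imset //; exact: lift_inj. Qed.

Lemma max_notin_old m (F : {set 'I_m}) : (ord_max \in old_vertices F) = false.
Proof. by apply/imsetP => -[j _ /eqP]; rewrite (negbTE (neq_lift _ _)). Qed.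

Lemma card_old_vertices m (F : {set 'I_m}) : #|old_vertices F| = #|F|.
Proof. by rewrite card_imset //; exact: lift_inj. Qed.

Lemma card_cone_vertices m (F : {set 'I_m}) : #|ord_max |: old_vertices F| = #|F|.+1.
Proof. by rewrite cardsU1 max_notin_old card_old_vertices. Qed.

Lemma old_verticesS m (F G : {set 'I_m}) :
  F \subset G -> old_vertices F \subset old_vertices G.
Proof. exact: imsetS. Qed.

Lemma ord_max_liftP m (P : 'I_m.+1 -> Prop) :
  P ord_max -> (forall j, P (lift ord_max j)) -> forall i, P i.
Proof. by move=> Pm Pl i; case: (unliftP ord_max i) => [j|] ->. Qed.

Lemma zeros_append k (s : k.-tuple sign) e : zeros (append s e) =
  if e == Zero then ord_max |: old_vertices (zeros s) else old_vertices (zeros s).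
Proof.
apply/setP; apply: ord_max_liftP => [|j].
  by rewrite inE tnth_append_max; case: eqP; rewrite ?inE ?eqxx ?max_notin_old.
rewrite inE tnth_append_old; case: (e == Zero);
  rewrite ?in_setU1 mem_old_vertices inE //.
by rewrite [lift _ _ == _]eq_sym (negbTE (neq_lift _ _)).
Qed.

Lemma card_zeros_append k (s : k.-tuple sign) e :
  #|zeros (append s e)| = (e == Zero) + #|zeros s|.
Proof.
rewrite zeros_append.
by case: eqP; rewrite ?card_cone_vertices ?card_old_vertices.
Qed.

Lemma face_ofP k (s t : k.-tuple sign) :
  reflect (forall j, tnth t j <> Zero -> tnth s j = tnth t j) (face_of s t).
Proof.
apply: (iffP forallP) => h j; last by apply/implyP => /eqP /h /eqP.
by move=> /eqP tj; have /implyP/(_ tj)/eqP := h j.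
Qed.

Lemma face_of_refl k (s : k.-tuple sign) : face_of s s.
Proof. exact/face_ofP. Qed.

Lemma face_of_trans k (s t u : k.-tuple sign) :
  face_of s t -> face_of t u -> face_of s u.
Proof.
move=> /face_ofP st /face_ofP tu; apply/face_ofP => j uj.
by rewrite st ?tu.
Qed.

Lemma face_of_zeros k (s t : k.-tuple sign) : face_of s t -> zeros s \subset zeros t.
Proof.
move=> /face_ofP st; apply/fintype.subsetP => j; rewrite !inE => /eqP sj.
by case: eqP => // /[dup] tj /st; rewrite sj => /esym.
Qed.

Lemma face_of_zeros_eq k (s t : k.-tuple sign) :
  face_of s t -> zeros t \subset zeros s -> t = s.
Proof.
move=> /face_ofP st /fintype.subsetP ts; apply: eq_from_tnth => j.
have [tj|/eqP tj] := eqVneq (tnth t j) Zero; last by rewrite st.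
by have := ts j; rewrite !inE tj eqxx => /(_ isT)/eqP.
Qed.

Lemma face_of_card k (s t : k.-tuple sign) :
  face_of s t -> #|zeros t| <= #|zeros s| -> t = s.
Proof.
move=> st le; apply: (face_of_zeros_eq st).
by have /eqP -> : zeros s == zeros t by rewrite eqEcard face_of_zeros.
Qed.

Lemma face_of_append k (s t : k.-tuple sign) e e' :
  face_of (append s e) (append t e') =
  face_of s t && ((e' == Zero) || (e == e')).
Proof.
apply/idP/andP => [/face_ofP st|[/face_ofP st ee']].
  split.
    apply/face_ofP => j.
    by have := st (lift ord_max j); rewrite !tnth_append_old.
  by have := st ord_max; rewrite !tnth_append_max; case: eqP => //= ne /(_ ne) ->.
apply/face_ofP; apply: ord_max_liftP => [|j]; last first.
  by rewrite !tnth_append_old; exact: st.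
by rewrite !tnth_append_max => /eqP/negbTE e'0; move: ee'; rewrite e'0 => /eqP.
Qed.

(** Setting the coordinates in [G] to [Zero] carries purity over from a simplicial complex to its
    mirror complex. *)
Lemma enlarge_zeros k (s : k.-tuple sign) (G : {set 'I_k}) :
  zeros s \subset G -> exists2 t, face_of s t & zeros t = G.
Proof.
move=> /fintype.subsetP sG; exists [tuple if j \in G then Zero else tnth s j | j < k].
  by apply/face_ofP => j; rewrite tnth_mktuple; case: ifP.
apply/setP => j; rewrite inE tnth_mktuple; case: ifP => // /negbT.
by apply: contraNF => sj; apply: sG; rewrite inE.
Qed.

Lemma facetP k (X : {set k.-tuple sign}) s :
  reflect (s \in X /\ forall t, t \in X -> face_of s t -> t = s) (facet X s).
Proof.
apply: (iffP andP) => -[sX h]; split=> //.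
  by move=> t tX st; have /forall_inP/(_ t tX)/implyP/(_ st)/eqP := h.
by apply/forall_inP => t tX; apply/implyP => st; apply/eqP; exact: h.
Qed.

(** Purity is built into the definition: the [G] that witnesses [F] witnesses itself too. *)
Lemma boundaryP d m (D : {set {set 'I_m}}) (F : {set 'I_m}) : F \in boundary d D ->
  exists G : {set 'I_m}, [/\ G \in boundary d D, #|G| = d, G \in D & F \subset G].
Proof.
rewrite inE => /existsP[G /and4P[GD Gd Gf FG]]; exists G; split=> //.
  by rewrite inE; apply/existsP; exists G; rewrite GD Gd Gf subxx.
exact/eqP.
Qed.

Lemma card_boundary d m (D : {set {set 'I_m}}) F : F \in boundary d D -> #|F| <= d.
Proof. by move=> /boundaryP[G [_ <- _]]; exact: subset_leq_card. Qed.

(** * Facets after one step of the construction *)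

Lemma mem_BBC_step d k (S : {set k.-tuple sign}) (D : {set {set 'I_k}}) s e :
  (append s e \in BBC_step d S D) =
  match e with
  | Plus => zeros s \in D
  | Zero => zeros s \in boundary d.-1 D
  | Minus => s \in remainder S D
  end.
Proof.
have mem (X : {set k.-tuple sign}) e' :
    (append s e \in [set append t e' | t in X]) = (s \in X) && (e == e').
  apply/imsetP/andP => [[t tX /append_inj[-> ->]]|[sX /eqP->]].
    by rewrite tX eqxx.
  by exists s.
rewrite !finset.in_setU !mem; case: e {mem}; rewrite ?eqxx ?andbT ?andbF ?orbF //=.
- by rewrite inE.
- by rewrite inE.
Qed.

Lemma remainderP k (S : {set k.-tuple sign}) (D : {set {set 'I_k}}) s :
  reflect (exists t, [/\ facet S t, zeros t \notin D & face_of s t])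
    (s \in remainder S D).
Proof.
rewrite inE; apply: (iffP existsP) => -[t].
  by case/and3P; rewrite inE; exists t.
by case=> *; exists t; rewrite inE; apply/and3P.
Qed.

(** A face lies only in faces with the same last sign or with last sign [Zero]. Purity turns
    maximality within the slices [Plus] and [Zero] into a count of zeros, and the slice [Zero]
    absorbs no facet of the outer slices. *)
Lemma facet_BBC_step d k (S : {set k.-tuple sign}) (D : {set {set 'I_k}}) s e :
  0 < d -> simplicial_complex D -> (forall F : {set 'I_k}, F \in D -> #|F| <= d) ->
  (forall F : {set 'I_k}, F \in D ->
    exists G : {set 'I_k}, [/\ G \in D, #|G| = d & F \subset G]) ->
  facet (BBC_step d S D) (append s e) <->
  match e with
  | Plus => zeros s \in D /\ #|zeros s| = d
  | Zero => zeros s \in boundary d.-1 D /\ #|zeros s| = d.-1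
  | Minus => facet S s /\ zeros s \notin D
  end.
Proof.
move=> d0 [_ Dsub] Dd Dpure; split.
  move=> /facetP[]; rewrite mem_BBC_step; case: e => sX smax.
  - split=> //; have [G [Gb Gd GD /enlarge_zeros[t st tG]]] := boundaryP sX.
    have /append_inj[ts _] : append t Zero = append s Zero.
      by apply: smax; rewrite ?mem_BBC_step ?tG // face_of_append st.
    by rewrite -ts tG.
  - split=> //; have [G [GD Gd /enlarge_zeros[t st tG]]] := Dpure _ sX.
    have /append_inj[ts _] : append t Plus = append s Plus.
      by apply: smax; rewrite ?mem_BBC_step ?tG // face_of_append st.
    by rewrite -ts tG.
  - have /remainderP[t [tS tD st]] := sX.
    have /append_inj[<- _] // : append t Minus = append s Minus.
    apply: smax; last by rewrite face_of_append st.
    by rewrite mem_BBC_step; apply/remainderP; exists t; rewrite face_of_refl.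
move=> h; apply/facetP; rewrite mem_BBC_step; case: e h => [] [sX sd].
- split=> // u; have [t [e ->]] := append_surj u.
  rewrite mem_BBC_step face_of_append => tX /andP[st].
  case: e tX => // tX _; rewrite (face_of_card st) // sd.
  exact: card_boundary tX.
- split=> // u; have [t [e ->]] := append_surj u.
  rewrite mem_BBC_step face_of_append => tX /andP[st].
  case: e tX => // tX _; last by rewrite (face_of_card st) // sd Dd.
  (* Here [t] has at most [d - 1] zeros and cannot contain [s], which has [d]. *)
  have := leq_trans (subset_leq_card (face_of_zeros st)) (card_boundary tX).
  by rewrite sd; lia.
split; first by apply/remainderP; exists s; rewrite face_of_refl.
move=> u; have [t [e ->]] := append_surj u.
rewrite mem_BBC_step face_of_append => tX /andP[st].
case: e tX => // tX _.
  (* A containing face that ends in [Zero] would force [zeros s] into [D]. *)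
  have [G [_ _ GD tG]] := boundaryP tX.
  by rewrite (Dsub _ _ (fintype.subset_trans (face_of_zeros st) tG) GD) in sd.
have /remainderP[v [/facetP[vS _] vD tv]] := tX.
have /facetP[_ smax] := sX.
have vs := smax _ vS (face_of_trans st tv).
by rewrite (face_of_zeros_eq st) // -vs face_of_zeros.
Qed.

(** The apex may be added to or removed from any face of a cone, so the last sign has no
    influence. *)
Lemma zeros_cone m (B : {set {set 'I_m}}) (s : m.-tuple sign) e :
  (zeros (append s e) \in cone B) = (zeros s \in B).
Proof.
rewrite zeros_append inE; have oinj : injective (@old_vertices m).
  by apply: imset_inj; exact: lift_inj.
have cinj : injective (fun F : {set 'I_m} => ord_max |: old_vertices F).
  move=> F G /setP h; apply/setP => j; have := h (lift ord_max j).
  by rewrite !inE eq_sym (negbTE (neq_lift _ _)) !mem_old_vertices.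
case: eqP => _.
  have -> : (ord_max |: old_vertices (zeros s) \in
      [set ord_max |: old_vertices F | F in B]) = (zeros s \in B).
    exact: (mem_imset B (zeros s) cinj).
  rewrite orbC; case: (zeros s \in B) => //=.
  apply/imsetP => -[F _ /setP/(_ ord_max)].
  by rewrite !inE eqxx !max_notin_old.
rewrite mem_imset //; case: (zeros s \in B) => //=.
apply/imsetP => -[F _ /setP/(_ ord_max)].
by rewrite !inE eqxx !max_notin_old.
Qed.

Lemma cone_dim d m (B : {set {set 'I_m}}) (F : {set 'I_m.+1}) :
  (forall F : {set 'I_m}, F \in B -> #|F| <= d) -> F \in cone B -> #|F| <= d.+1.
Proof.
move=> Bd; rewrite inE => /orP[] /imsetP[G /Bd le ->].
  by rewrite card_old_vertices (leq_trans le).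
by rewrite card_cone_vertices.
Qed.

Lemma cone_pure d m (B : {set {set 'I_m}}) (F : {set 'I_m.+1}) :
  (forall F : {set 'I_m}, F \in B ->
    exists G : {set 'I_m}, [/\ G \in B, #|G| = d & F \subset G]) ->
  F \in cone B ->
  exists G : {set 'I_m.+1}, [/\ G \in cone B, #|G| = d.+1 & F \subset G].
Proof.
move=> Bp; rewrite inE => /orP[] /imsetP[F' /Bp[G [GB Gd FG]] ->];
  exists (ord_max |: old_vertices G);
  rewrite card_cone_vertices Gd finset.in_setU
    (imset_f (fun F => _ |: old_vertices F)) // orbT;
  split=> //.
  by rewrite (fintype.subset_trans (old_verticesS FG)) ?finset.subsetUr.
by rewrite finset.setUS ?old_verticesS.
Qed.

Lemma facet_cube_boundary k (s : k.+1.-tuple sign) :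
  facet (cube_boundary k.+1) s <-> #|zeros s| = k.
Proof.
have inX (t : k.+1.-tuple sign) : (t \in cube_boundary k.+1) = (#|zeros t| < k.+1).
  rewrite inE -[X in _ < X]card_ord -cardsT; apply/existsP/idP => [[j tj]|].
    apply: proper_card; rewrite properT.
    by apply: contraNneq tj => /setP/(_ j); rewrite !inE.
  apply: contraTP => h; rewrite -leqNgt; apply: subset_leq_card.
  by apply/fintype.subsetP => j _; rewrite inE; apply: contraT => tj; case: h; exists j.
split=> [/facetP[sX smax]|sk].
  have := sX; rewrite inE => /existsP[j sj].
  (* Freeing all coordinates but one nonzero [j] gives a larger face with [k] zeros. *)
  have sub : zeros s \subset [set~ j].
    by apply/fintype.subsetP => i; rewrite !inE; apply: contraTneq => ->.
  have [t st tz] := enlarge_zeros sub.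
  have cj : #|[set~ j]| = k by rewrite cardsC1 card_ord.
  by rewrite -(smax t) // ?inX tz cj.
apply/facetP; split=> [|t]; rewrite inX ?sk // ltnS => tX st.
by rewrite (face_of_card st) ?sk.
Qed.

Lemma trailing_nonzeros_append k (s : k.-tuple sign) e :
  trailing_nonzeros (append s e) = if e == Zero then 0 else (trailing_nonzeros s).+1.
Proof. by rewrite /trailing_nonzeros /= rev_rcons /=; case: eqP. Qed.

Lemma zeros_full k (s : k.-tuple sign) : #|zeros s| = k -> tval s = nseq k Zero.
Proof.
move=> sk; have zT : zeros s = [set: 'I_k].
  by apply/eqP; rewrite eqEcard finset.subsetT cardsT card_ord sk leqnn.
apply: (@eq_from_nth _ Zero); rewrite size_tuple ?size_nseq // => i ik.
have := finset.in_setT (Ordinal ik); rewrite -zT inE (tnth_nth Zero) /= => /eqP ->.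
by rewrite nth_nseq ik.
Qed.

End Facets.

(** The case list for arbitrary [n], as the induction requires. For [0 < t < n - d] the index
    [(n - t).-1.+1] is [n - t], in the form imposed by the type of [append beta Zero]. *)
Definition facet_type d n (T : forall i, {set {set 'I_i}}) (alpha : n.-tuple sign)
    (t : nat) : Prop :=
  [\/ t = 0 /\
      (exists beta : (n.-1).-tuple sign,
         tval alpha = rcons beta Zero /\
         zeros beta \in boundary d.-1 (T n.-1)),
      0 < t < n - d /\
      (exists (beta : ((n - t).-1).-tuple sign) (s : sign),
         [/\ s = Plus \/ s = Minus,
             tval alpha = beta ++ [:: Zero; s] ++ nseq t.-1 Minus,
             zeros beta \in boundary d.-1 (T (n - t).-1),
             s = Plus -> zeros (append beta Zero) \in T (n - t).-1.+1 &
             s = Minus ->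
               zeros (append beta Zero) \notin T (n - t).-1.+1])
    | t = n - d /\
      (exists s : sign,
         (s = Plus \/ s = Minus) /\
         tval alpha = nseq d Zero ++ s :: nseq (n - d).-1 Minus)].

Lemma rcons_nseq (A : Type) k (x : A) : rcons (nseq k x) x = nseq k.+1 x.
Proof. by elim: k => //= k ->. Qed.

Lemma cat_pair_nseqS (A : Type) (b : seq A) x y z t :
  b ++ [:: x; y] ++ nseq t.+1 z = rcons (b ++ [:: x; y] ++ nseq t z) z.
Proof. by rewrite -rcons_nseq -!rcons_cat. Qed.

Lemma cat_pair_nseq0 (A : Type) (b : seq A) x y z :
  b ++ [:: x; y] ++ nseq 0 z = rcons (rcons b x) y.
Proof. by rewrite -!cats1 -catA. Qed.

Lemma cat_cons_nseqS (A : Type) (b : seq A) y z t :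
  b ++ y :: nseq t.+1 z = rcons (b ++ y :: nseq t z) z.
Proof. by rewrite -rcons_nseq -rcons_cons -rcons_cat. Qed.

(** * Behaviour of the types when a sign is appended *)

Section FacetTypes.
Variables (d : nat) (T : forall i : nat, {set {set 'I_i}}).

(** With [d] zeros among [d + 1] entries, either the last entry is [Zero], or it is the only nonzero
    one and the type is [1 = n - d]. *)
Lemma facet_type_base (s : d.-tuple sign) e : 0 < d -> T d = [set: {set 'I_d}]%SET ->
  #|zeros (append s e)| = d ->
  facet_type d T (append s e) (trailing_nonzeros (append s e)).
Proof.
move=> d0 Td; rewrite card_zeros_append trailing_nonzeros_append.
case: eqP => [->|ne] /= c.
  constructor 1; split=> //; exists s; split=> //=.
  rewrite inE; apply/existsP; exists (zeros s).
  rewrite Td finset.in_setT subxx andbT /=; apply/andP; split; first by apply/eqP; lia.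
  (* Only the full simplex has [d] vertices, so every set of [d - 1] vertices lies in the
     boundary. *)
  rewrite (_ : finset _ = [set [set: 'I_d]%SET]%SET) ?cards1 //.
  apply/setP => H; rewrite !inE /= prednK //.
  apply/andP/eqP => [[_ /eqP Hd]|->]; last by rewrite finset.subsetT cardsT card_ord.
  by apply/eqP; rewrite eqEcard finset.subsetT cardsT card_ord Hd leqnn.
rewrite add0n in c; have sz := zeros_full c.
have -> : trailing_nonzeros s = 0.
  by rewrite /trailing_nonzeros sz; case: (d) d0 => // k _; rewrite rev_nseq.
constructor 3; rewrite subSnn; split=> //; exists e; split; first by case: e ne; auto.
by rewrite /= sz -cats1.
Qed.

Variable k : nat.
Hypothesis dk : d <= k.

Lemma facet_type_Zero (s : k.+1.-tuple sign) :
  facet_type d T (append s Zero) 0 <-> zeros s \in boundary d.-1 (T k.+1).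
Proof.
split=> [[[_ [b [/= /rcons_inj[/val_inj -> //]]]]|[] //|[]]|sb].
  by rewrite subSn ?(leq_trans dk).
by constructor 1; split=> //; exists s.
Qed.

(** Types above 1 end in [Minus], which leaves type 1. Conversely, faces of [B] have fewer than [d]
    vertices, so a face of the cone with [d] vertices contains the apex and [s] ends in [Zero]. *)
Lemma facet_type_Plus (B : {set {set 'I_k}}) (s : k.+1.-tuple sign) :
  0 < d -> B \subset boundary d.-1 (T k) -> T k.+1 = cone B -> #|zeros s| = d ->
  facet_type d T (append s Plus) (trailing_nonzeros s).+1 <-> zeros s \in T k.+1.
Proof.
move=> d0 /fintype.subsetP Bb Tk sd; split.
  case=> [[] //|[_ [b [e [_ eq _ hP _]]]]|[_ [e [_ eq]]]].
    move: b eq hP; case: (trailing_nonzeros s) => [|t] b eq hP.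
      move: eq; rewrite cat_pair_nseq0 => /rcons_inj[eqs ep].
      have -> : s = append b Zero by apply: val_inj.
      exact: hP.
    by move: eq; rewrite [t.+2.-1]/= cat_pair_nseqS => /rcons_inj[].
  by move: eq; rewrite !subSn ?(leq_trans dk) //= cat_cons_nseqS => /rcons_inj[].
have [b [e se]] := append_surj s; rewrite se Tk zeros_cone => bB.
have e0 : e = Zero.
  move: sd; rewrite se card_zeros_append; case: eqP => // _.
  by have := card_boundary (Bb _ bB); lia.
rewrite e0 trailing_nonzeros_append eqxx; constructor 2.
split; first by rewrite ltn_subRL; lia.
exists b, Plus; split=> //; first by left.
- by rewrite cat_pair_nseq0.
- exact: Bb.
- by move=> _; rewrite Tk zeros_cone.
Qed.

(** Appending [Minus] after a nonzero entry raises the type by one and keeps [beta], the sign after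
    it and [n - t]; the condition on [T k.+1] is then automatic. After [Zero], that condition is the
    one for [s = Minus] in type 1. *)
Lemma facet_type_Minus (B : {set {set 'I_k}}) (s : k.+1.-tuple sign) :
  0 < d -> B \subset boundary d.-1 (T k) -> T k.+1 = cone B -> #|zeros s| = d ->
  facet_type d T (append s Minus) (trailing_nonzeros s).+1 <->
  facet_type d T s (trailing_nonzeros s) /\ zeros s \notin T k.+1.
Proof.
move=> d0 /fintype.subsetP Bb Tk sd.
(* A face with [d] vertices avoiding the apex would be a face of [B], whose faces have at most
   [d - 1]. *)
have last_nz : 0 < trailing_nonzeros s -> zeros s \notin T k.+1.
  have [b [e se]] := append_surj s.
  rewrite se Tk zeros_cone trailing_nonzeros_append; case: eqP => // ne _.
  apply/negP => /Bb/card_boundary; move: sd; rewrite se card_zeros_append.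
  by case: eqP => // _; lia.
split.
  case=> [[] //|[tlt [b [e [he eq bb hP hM]]]]|[tE [e [he eq]]]].
    move: (trailing_nonzeros s) b tlt eq bb hP hM last_nz => [|t] b tlt eq bb hP hM nz.
      move: eq; rewrite cat_pair_nseq0 => /rcons_inj[eqs em].
      have sE : s = append b Zero by apply: val_inj.
      split; first by constructor 1; split=> //; exists b.
      by rewrite sE; apply: hM.
    move: eq; rewrite [t.+2.-1]/= cat_pair_nseqS => /rcons_inj[eqs].
    split; last exact: nz.
    constructor 2; split; first by lia.
    by exists b, e; split.
  have tE' : trailing_nonzeros s = k.+1 - d by lia.
  move: eq; rewrite !subSn ?(leq_trans dk) //= cat_cons_nseqS => /rcons_inj[eqs].
  split; last by apply: last_nz; lia.
  constructor 3; split=> //; exists e; split=> //.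
  by rewrite subSn.
case=> -[[tE [b [eq bb]]]|[tlt [b [e [he eq bb hP hM]]]]|[tE [e [he eq]]]] sT.
- have sE : s = append b Zero by apply: val_inj.
  rewrite tE; constructor 2; split; first by lia.
  exists b, Minus; split=> //; first by right.
    by rewrite cat_pair_nseq0 -eq.
  by rewrite /= -sE.
- move: (trailing_nonzeros s) b tlt eq bb hP hM {last_nz} => [|t] b tlt eq bb hP hM //.
  constructor 2; split; first by lia.
  exists b, e; split=> //.
  by rewrite [t.+2.-1]/= cat_pair_nseqS -eq.
- constructor 3; rewrite tE; split; first by lia.
  exists e; split=> //; rewrite /= eq [in RHS]subSn ?(leq_trans dk) //= subSn //.
  by rewrite cat_cons_nseqS.
Qed.

End FacetTypes.

(** An inclusion-maximal face above [F] has more than [k] vertices by [ball_maximal_face]. *)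
Lemma ball_pure (R : realType) k m (B : {set {set 'I_m}}) (F : {set 'I_m}) :
  simplicial_ball R k B -> (forall F : {set 'I_m}, F \in B -> #|F| <= k.+1) ->
  F \in B -> exists G : {set 'I_m}, [/\ G \in B, #|G| = k.+1 & F \subset G].
Proof.
move=> ballB dimB FB.
have [G /maxsetP[GB Gmax] FG] := maxset_exists (P := mem B) FB.
exists G; split=> //; apply/eqP; rewrite eqn_leq dimB //=.
exact: (ball_maximal_face ballB GB).
Qed.

(** * Induction along the complexes *)

Lemma BBC_succ d T k : d < k ->
  BBC d T k.+1 = BBC_step d (BBC d T k) (T k).
Proof. by move=> dk; rewrite /= ltnNge (ltnW dk) /= gtn_eqF. Qed.

Lemma facet_BBC (R : realType) (n d : nat) (T : forall i : nat, {set {set 'I_i}})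
    (hd : 2 < d) (hT : BBC_sequence R d n T) k (s : k.-tuple sign) : d < k <= n ->
  facet (BBC d T k) s <->
  #|zeros s| = d /\ facet_type d T s (trailing_nonzeros s).
Proof.
case: hT => ballT Td stepT; have d0 : 0 < d by lia.
elim: k s => [//|k IH] s /andP[]; rewrite ltnS leq_eqVlt => /predU1P[dk|dk] kn.
  case: k / dk kn s {IH} => _ s; rewrite /= ltnn eqxx.
  rewrite facet_cube_boundary; split=> [c|[]//]; split=> //.
  by have [t [e se]] := append_surj s; rewrite se in c *; exact: facet_type_base.
rewrite BBC_succ //.
case: k dk kn s IH => [//|k] dk' kn s IH; have dk : d <= k := dk'.
have [B [ballB _ Bb Tk]] := stepT k dk kn.
(* The size bound comes from [B] lying in the boundary of the previous ball, purity from [B] being a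
   ball itself; both pass to the cone [T k.+1]. *)
have dimB (F : {set 'I_k}) : F \in B -> #|F| <= d.-1.
  by move=> /(fintype.subsetP Bb)/card_boundary.
have pureB (F : {set 'I_k}) : F \in B ->
    exists G : {set 'I_k}, [/\ G \in B, #|G| = d.-1 & F \subset G].
  have dE : d.-1 = d.-2.+1 by lia.
  by rewrite dE; apply: ball_pure ballB _ => G; rewrite -dE; exact: dimB.
have [[cT _] _] : simplicial_ball R d.-1 (T k.+1) /\ has_full_vertex_set (T k.+1).
  by apply: ballT; lia.
have dimT (F : {set 'I_k.+1}) : F \in T k.+1 -> #|F| <= d.
  by rewrite Tk => /(cone_dim dimB); rewrite prednK.
have pureT (F : {set 'I_k.+1}) : F \in T k.+1 ->
    exists G : {set 'I_k.+1}, [/\ G \in T k.+1, #|G| = d & F \subset G].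
  by rewrite Tk => /(cone_pure pureB); rewrite prednK.
have {}IH (t : k.+1.-tuple sign) : facet (BBC d T k.+1) t <->
    #|zeros t| = d /\ facet_type d T t (trailing_nonzeros t).
  by apply: IH; rewrite dk' ltnW.
move: (BBC d T k.+1) IH => S IH; have [t [e ->]] := append_surj s.
rewrite (facet_BBC_step _ _ _ d0 cT dimT pureT).
rewrite card_zeros_append trailing_nonzeros_append.
case: e => /=.
- rewrite facet_type_Zero //; split=> -[h1 h2]; split=> //; lia.
- rewrite add0n; split=> -[h1 h2]; split=> //.
    by apply/(facet_type_Plus dk d0 Bb Tk h2).
  by apply/(facet_type_Plus dk d0 Bb Tk h1).
- rewrite add0n IH; split=> [[[h1 h2] h3]|[h1 h2]].
    by split=> //; apply/(facet_type_Minus dk d0 Bb Tk h1).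
  by have /(facet_type_Minus dk d0 Bb Tk h1)[] := h2.
Qed.

Theorem theorem3p1 (R : realType) (n d : nat)
    (T : forall i : nat, {set {set 'I_i}})
    (hd : 2 < d) (hn : d < n) (hT : BBC_sequence R d n T)
    (alpha : n.-tuple sign) :
  facet (BBC d T n) alpha <->
  #|zeros alpha| = d /\
  (let t := trailing_nonzeros alpha in
   [\/ t = 0 /\
       (exists beta : (n.-1).-tuple sign,
          tval alpha = rcons beta Zero /\
          zeros beta \in boundary d.-1 (T n.-1)),
       0 < t < n - d /\
       (exists (beta : ((n - t).-1).-tuple sign) (s : sign),
          [/\ s = Plus \/ s = Minus,
              tval alpha = beta ++ [:: Zero; s] ++ nseq t.-1 Minus,
              zeros beta \in boundary d.-1 (T (n - t).-1),
              s = Plus -> zeros (append beta Zero) \in T (n - t).-1.+1 &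
              s = Minus ->
                zeros (append beta Zero) \notin T (n - t).-1.+1])
     | t = n - d /\
       (exists s : sign,
          (s = Plus \/ s = Minus) /\
          tval alpha = nseq d Zero ++ s :: nseq (n - d).-1 Minus)]).
Proof. by apply: (facet_BBC hd hT); rewrite hn leqnn. Qed.
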